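(* Let $$L=(k+2)\sigma^2+(-6k-9)\sigma+(k+1),$$ and let $n$ be a positive integer. Then $$\sum_{k=0}^{n-1} L^{\ast}(p(k))D_k=n\bigl(p(n-1)D_{n-1}-p(n-2)D_n\bigr)$$ for any polynomial $p(k)\in\mathbb{Z}[k]$, where $L^{\ast}$ is the adjoint of $L$.
   Context: The central Delannoy numbers are $D_k=\sum_{i=0}^{k}\binom{k}{i}\binom{k+i}{i}$ for $k\ge 0$. $\sigma$ is the shift operator in $k$ ($\sigma F(k)=F(k+1)$). The adjoint of an operator $L=\sum_{i=0}^{J}a_i(k)\sigma^i$ with polynomial coefficients is $L^{\ast}=\sum_{i=0}^{J}\sigma^{-i}a_i(k)$, so that $L^{\ast}(p(k))=\sum_{i=0}^{J}a_i(k-i)p(k-i)$ for a polynomial $p(k)$. *)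

(* Defs.v *)
From mathcomp Require Import all_boot all_order all_algebra.

Set Implicit Arguments.
Unset Strict Implicit.
Unset Printing Implicit Defensive.

Import GRing.Theory.
Local Open Scope ring_scope.

Definition delannoy (k : nat) : nat :=
  (\sum_(0 <= i < k.+1) 'C(k, i) * 'C(k + i, i))%N.

Definition shiftp (R : comNzRingType) (j : int) (p : {poly R}) : {poly R} :=
  p \Po ('X + (j%:~R)%:P).

(* A recurrence operator \sum_(i <= J) a_i(k) sigma^i is given by the sequence
   [:: a_0; ...; a_J] of its coefficients, lowest power of sigma first and
   each coefficient on the left of its power of sigma; its action is not
   commutative, whence a sequence rather than a polynomial in sigma. *)
Definition recop (R : comNzRingType) := seq {poly R}.

(* sigma^-i is applied last, so it shifts the product a_i * p:
   (adjoint L p)(k) = \sum_i a_i(k - i) p(k - i). *)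
Definition adjoint (R : comNzRingType) (L : recop R) (p : {poly R}) :
    {poly R} :=
  \sum_(i < size L) shiftp (- i%:Z) (L`_i * p).

(* Main.v *)
(* By induction on [n] the identity reduces to the three-term recurrence
   [L D = 0]. The terms of [D_n] are the coefficients of the shifted Legendre
   polynomial P_n(1 + 2x) = \sum_i 'C(n, i) 'C(n + i, i) x^i, so the recurrence
   is Bonnet's relation
     (n + 2) P_(n+2) = (2n + 3) (1 + 2x) P_(n+1) - (n + 1) P_n
   at x = 1; it is proved coefficient by coefficient. *)
Require Import Defs.
From mathcomp Require Import all_boot all_order all_algebra.
From mathcomp Require Import ring zify.

Set Implicit Arguments.
Unset Strict Implicit.
Unset Printing Implicit Defensive.

Import GRing.Theory.
Local Open Scope ring_scope.

Definition legendre_coef (n i : nat) : nat := ('C(n, i) * 'C(n + i, i))%N.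

Lemma legendre_coef_small (n i : nat) : (n < i)%N -> legendre_coef n i = 0%N.
Proof. by move=> lt_ni; rewrite /legendre_coef bin_small. Qed.

(** Raising [n] multiplies the first binomial by (n+1)/(n+1-i) and the second by (n+1+i)/(n+1); the
    factors n+1 cancel. The form without division also covers i = n+1. *)
Lemma legendre_coefSn (n i : nat) :
  (n%:Z + 1 - i%:Z) * (legendre_coef n.+1 i)%:Z =
  (n%:Z + 1 + i%:Z) * (legendre_coef n i)%:Z.
Proof.
have [le_i|lt_i] := leqP i n.+1; last first.
  by rewrite !legendre_coef_small ?mulr0 // ltnW.
have /= h1 := mul_bin_down n.+1 i.
have /= h2 := mul_bin_down (n.+1 + i) i.
rewrite addnK addSn /= in h2.
rewrite /legendre_coef addSn.
apply: (@mulfI _ n.+1%:Z) => //.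
have {}h1 : (n%:Z + 1 - i%:Z) * 'C(n.+1, i)%:Z = n.+1%:Z * 'C(n, i)%:Z.
  by rewrite -[RHS]PoszM h1 PoszM; congr (_ * _); lia.
have {}h2 : n.+1%:Z * 'C((n + i).+1, i)%:Z = (n%:Z + 1 + i%:Z) * 'C(n + i, i)%:Z.
  by rewrite -PoszM -h2 PoszM; congr (_ * _); lia.
rewrite !PoszM.
transitivity (((n%:Z + 1 - i%:Z) * 'C(n.+1, i)%:Z) *
              (n.+1%:Z * 'C((n + i).+1, i)%:Z)); first by ring.
by rewrite h1 h2; ring.
Qed.

(** Raising [i] multiplies the binomials by (n-i)/(i+1) and (n+1+i)/(i+1). *)
Lemma legendre_coefnS (n i : nat) :
  (i%:Z + 1) ^+ 2 * (legendre_coef n i.+1)%:Z =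
  (n%:Z - i%:Z) * (n%:Z + 1 + i%:Z) * (legendre_coef n i)%:Z.
Proof.
have [le_i|lt_i] := leqP i n; last first.
  by rewrite !legendre_coef_small ?mulr0 // ltnW.
have h1 : (i%:Z + 1) * 'C(n, i.+1)%:Z = (n%:Z - i%:Z) * 'C(n, i)%:Z.
  by have := mul_bin_left n i; rewrite subzn // -!PoszM => <-; lia.
have h2 : (i%:Z + 1) * 'C((n + i).+1, i.+1)%:Z =
          (n%:Z + 1 + i%:Z) * 'C(n + i, i)%:Z.
  have /= := mul_bin_diag (n + i).+1 i => h.
  have -> : n%:Z + 1 + i%:Z = (n + i).+1%:Z by lia.
  by rewrite -PoszM h; lia.
rewrite /legendre_coef addnS !PoszM.
transitivity (((i%:Z + 1) * 'C(n, i.+1)%:Z) *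
              ((i%:Z + 1) * 'C((n + i).+1, i.+1)%:Z)); first by ring.
by rewrite h1 h2; ring.
Qed.

Lemma legendre_coef_bonnet (n i : nat) :
  (n%:Z + 2) * (legendre_coef n.+2 i.+1)%:Z =
  (2 * n%:Z + 3) * ((legendre_coef n.+1 i.+1)%:Z + 2 * (legendre_coef n.+1 i)%:Z)
  - (n%:Z + 1) * (legendre_coef n i.+1)%:Z.
Proof.
(* The factor (i+1)^2 lets [legendre_coefnS] lower every index i+1 to i. *)
apply: (@mulfI _ ((i%:Z + 1) ^+ 2)); first by rewrite expf_neq0 //; lia.
have e2 := legendre_coefnS n.+2 i; have e1 := legendre_coefnS n.+1 i.
have e0 := legendre_coefnS n i.
have f1 := legendre_coefSn n.+1 i; have f0 := legendre_coefSn n i.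
have S1 : n.+1%:Z = n%:Z + 1 by lia.
have S2 : n.+2%:Z = n%:Z + 2 by lia.
rewrite ?S1 ?S2 in e2 e1 f1.
rewrite mulrBr mulrCA e2 (mulrCA _ (n%:Z + 1)) e0 (mulrCA _ (2 * n%:Z + 3)).
rewrite [(i%:Z + 1) ^+ 2 * (_ + _)]mulrDr e1.
(* The factors n+2-i and n+1+i just produced are those that [legendre_coefSn] needs to turn the
   coefficients for n+2 and n into multiples of [legendre_coef n.+1 i]; a polynomial identity in n
   and i remains. *)
transitivity ((n%:Z + 2) * (n%:Z + 3 + i%:Z) *
  ((n%:Z + 1 + 1 - i%:Z) * (legendre_coef n.+2 i)%:Z)); first by ring.
rewrite f1 -(mulrA (n%:Z - i%:Z)) -f0.
by ring.
Qed.

(** Padding with zero terms gives three consecutive Delannoy numbers a common summation range. *)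
Lemma delannoyE (n m : nat) : (n < m)%N ->
  (delannoy n)%:Z = \sum_(0 <= i < m) (legendre_coef n i)%:Z.
Proof.
move=> lt_nm; rewrite (big_cat_nat (n := n.+1)) //=.
rewrite [X in _ + X]big_nat_cond [X in _ + X]big1 ?addr0.
  by rewrite /delannoy -natz natr_sum; apply: eq_bigr => i _; rewrite natz.
by move=> i /andP[/andP[lt_ni _] _]; rewrite legendre_coef_small.
Qed.

Lemma delannoy_rec (n : nat) :
  (n%:Z + 2) * (delannoy n.+2)%:Z =
  (6 * n%:Z + 9) * (delannoy n.+1)%:Z - (n%:Z + 1) * (delannoy n)%:Z.
Proof.
(* The coefficientwise relation only reaches indices i+1; the constant terms, all 1, agree since n+2
   = (2n+3) - (n+1). *)
have split0 k : (k < n.+3)%N -> (delannoy k)%:Z =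
    1 + \sum_(0 <= i < n.+2) (legendre_coef k i.+1)%:Z.
  by move=> lt_k; rewrite (delannoyE lt_k) big_nat_recl // /legendre_coef !bin0.
have bonnet : (n%:Z + 2) * \sum_(0 <= i < n.+2) (legendre_coef n.+2 i.+1)%:Z =
    (2 * n%:Z + 3) * (\sum_(0 <= i < n.+2) (legendre_coef n.+1 i.+1)%:Z +
                      2 * (delannoy n.+1)%:Z)
    - (n%:Z + 1) * \sum_(0 <= i < n.+2) (legendre_coef n i.+1)%:Z.
  rewrite (delannoyE (ltnSn n.+1)) (mulr_sumr _ _ _ 2) -big_split /= !mulr_sumr.
  by rewrite -sumrB; apply: eq_bigr => i _; apply: legendre_coef_bonnet.
have e1 : \sum_(0 <= i < n.+2) (legendre_coef n.+1 i.+1)%:Z =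
    (delannoy n.+1)%:Z - 1.
  by rewrite split0 // addrAC subrr add0r.
rewrite e1 in bonnet.
rewrite (split0 n.+2) // (split0 n) ?(leqW (leqW _)) // mulrDr bonnet.
by ring.
Qed.

Lemma horner_shiftp (R : comNzRingType) (j : int) (p : {poly R}) (x : R) :
  (shiftp j p).[x] = p.[x + j%:~R].
Proof. by rewrite /shiftp horner_comp !hornerE. Qed.

Theorem theorem8 (n : nat) (hn : (0 < n)%N) (p : {poly int}) :
  let L : recop int := [:: 'X + 1; - 6 *: 'X - 9; 'X + 2] in
  \sum_(0 <= k < n) (adjoint L p).[k%:Z] * (delannoy k)%:Z =
  n%:Z * (p.[n%:Z - 1] * (delannoy (n - 1))%:Z
          - p.[n%:Z - 2] * (delannoy n)%:Z).
Proof.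
move=> L.
(* The shifted coefficients are -6(x-1)-9 = -(6x+3) and (x-2)+2 = x. *)
have adjE (x : int) : (adjoint L p).[x] =
    (x + 1) * p.[x] - (6 * x + 3) * p.[x - 1] + x * p.[x - 2].
  have hornern (m : nat) y : (m%:R : {poly int}).[y] = m%:R.
    by rewrite -polyC_natr hornerC.
  have a0E y : ('X + 1 : {poly int}).[y] = y + 1.
    by rewrite hornerD hornerX hornerC.
  have a1E y : (- 6 *: 'X - 9 : {poly int}).[y] = - 6 * y - 9.
    by rewrite hornerD hornerN hornerZ hornerX hornern.
  have a2E y : ('X + 2 : {poly int}).[y] = y + 2.
    by rewrite hornerD hornerX hornern.
  rewrite /adjoint !big_ord_recl big_ord0 addr0 !hornerD !horner_shiftp.
  rewrite !hornerM /= /bump /= !addn0 a0E a1E a2E !intz oppr0 addr0.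
  have -> : Posz (1 + 1) = 2 by [].
  have -> : Posz 1 = 1 by [].
  by ring.
case: n hn => // n _; elim: n => [|n IHn].
  have D0 : delannoy 0 = 1%N by rewrite /delannoy big_nat1.
  have D1 : delannoy 1 = 3 by rewrite /delannoy big_nat_recr //= big_nat1.
  by rewrite big_nat1 adjE subnn D0 D1 !sub0r; ring.
rewrite big_nat_recr //= {}IHn adjE !subn1 /=.
have S1 : n.+1%:Z = n%:Z + 1 by lia.
have S2 : n.+2%:Z = n%:Z + 2 by lia.
have -> : n.+2%:Z - 1 = n.+1%:Z by lia.
have -> : n.+2%:Z - 2 = n.+1%:Z - 1 by lia.
(* The p(n-1) terms on the left cancel, the p(n+1) terms match, and equality of the p(n) terms is
   the recurrence for (n+2) D_(n+2). *)
rewrite [RHS]mulrBr [X in _ = _ - X]mulrCA S2 delannoy_rec S1.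
by ring.
Qed.
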